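(* Let $n=k+m$, $0\le k<n$. Let $\mathfrak{gl}_{k,m}$ be the unital associative $\mathbb C$-algebra generated by $h_z$, $z\in X_k^+$ (invertible), and $L^{(1)}_{x,y}$, $x,y\in[n]$, with the relations (where $h_z:=1$ for $z\in[k]$, and $x,y,z,w\in[n]$ unless restricted) $$[h_x,h_y]=0,\quad x,y\in X_k^+,$$ $$[L^{(1)}_{x,y},h_z]=2L^{(1)}_{x,y}h_x\delta_{z,x}-2h_yL^{(1)}_{x,y}\delta_{y,z},\quad z\in X_k^+,$$ $$[L^{(1)}_{x,y},L^{(1)}_{z,w}]-2L^{(1)}_{x,y}L^{(1)}_{x,w}\,\delta_{x,z}\mathbf 1_{x\in X_k^+}+2L^{(1)}_{z,y}L^{(1)}_{x,y}\,\delta_{y,w}\mathbf 1_{y\in X_k^+}=L^{(1)}_{z,y}h_x\delta_{x,w}-h_yL^{(1)}_{x,w}\delta_{y,z}.$$ Then $\mathfrak{gl}_{k,m}$ is a subalgebra of the Yangian $Y(\mathfrak{gl}_{k,m})$ (via $h_z\mapsto h_z$, $L^{(1)}_{x,y}\mapsto L^{(1)}_{x,y}$). In particular, $(L^{(1)}_{x,y})^2=0$ if $x\in[k]$ and $y\in X_k^+$, or $x\in X_k^+$ and $y\in[k]$.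
   Context: $[n]=\{1,\dots,n\}$, $X_k^+=\{k+1,\dots,n\}$, $[\mathrm a,\mathrm b]=\mathrm a\mathrm b-\mathrm b\mathrm a$, $\mathbf 1_{x\in X_k^+}$ is $1$ if $x\in X_k^+$ and $0$ otherwise, $\mathbb N=\{0,1,2,\dots\}$. The Yangian $Y(\mathfrak{gl}_{k,m})$ is the unital associative $\mathbb C$-algebra generated by $L^{(p)}_{x,y}$ ($x,y\in[n]$, $p\in\mathbb N$), where $L^{(0)}_{x,y}=\delta_{x,y}h_x$, $h_x=1$ for $x\in[k]$ and $h_x$ is an invertible generator for $x\in X_k^+$, subject to the relations, for all $x,y,z,w\in[n]$ and $l,p\in\mathbb N$: $[h_x,h_y]=0$ for $x,y\in X_k^+$; $[L^{(p)}_{x,y},h_z]=2L^{(p)}_{x,y}h_x\delta_{z,x}-2h_yL^{(p)}_{x,y}\delta_{z,y}$ for $z\in X_k^+$; and $$[L^{(p+1)}_{x,y},L^{(l)}_{z,w}]-[L^{(p)}_{x,y},L^{(l+1)}_{z,w}]-2\big(L^{(p+1)}_{x,y}L^{(l)}_{x,w}-L^{(p)}_{x,y}L^{(l+1)}_{x,w}\big)\delta_{x,z}\mathbf 1_{x\in X_k^+}+2\big(L^{(l)}_{z,y}L^{(p+1)}_{x,y}-L^{(l+1)}_{z,y}L^{(p)}_{x,y}\big)\delta_{y,w}\mathbf 1_{y\in X_k^+}=L^{(l)}_{z,y}L^{(p)}_{x,w}-L^{(p)}_{z,y}L^{(l)}_{x,w}.$$ *)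

(* Defs.v *)
From HB Require Import structures.
From mathcomp Require Import all_boot all_order all_algebra.
From mathcomp Require Import boolp.

Set Implicit Arguments.
Unset Strict Implicit.
Unset Printing Implicit Defensive.

Import GRing.Theory.
Local Open Scope ring_scope.
Local Open Scope quotient_scope.

(* The algebra presented by generators G and relations S is the type of formal
   algebra expressions over G modulo the least congruence that contains S and
   the axioms of unital associative K-algebras. *)

Inductive expr (K G : Type) :=
| Gen of G
| Zero
| One
| Opp of expr K G
| Add of expr K G & expr K G
| Mul of expr K G & expr K G
| Scale of K & expr K G.

Arguments Zero {K G}.
Arguments One {K G}.
Arguments Gen K [G] _.

HB.instance Definition _ K G := gen_eqMixin (expr K G).
HB.instance Definition _ K G := gen_choiceMixin (expr K G).

Declare Scope expr_scope.
Delimit Scope expr_scope with X.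
Bind Scope expr_scope with expr.
Notation "0" := Zero : expr_scope.
Notation "1" := One : expr_scope.
Notation "- s" := (Opp s) : expr_scope.
Notation "s + t" := (Add s t) : expr_scope.
Notation "s - t" := (Add s (Opp t)) : expr_scope.
Notation "s * t" := (Mul s t) : expr_scope.
Notation "c *: s" := (Scale c s) : expr_scope.
Notation "s *+ n" := (Scale n%:R%R s) : expr_scope.
Notation "[ 'lie' s , t ]" := (s * t - t * s)%X
  (at level 0, s at level 99, t at level 99) : expr_scope.

Section Congruence.
Variables (K : comNzRingType) (G : Type).
Implicit Types (S : expr K G -> expr K G -> Prop) (s t u : expr K G) (a b : K).

Inductive cong S : expr K G -> expr K G -> Prop :=
| cong_rel s t of S s t : cong S s t
| cong_refl s : cong S s s
| cong_sym s t of cong S s t : cong S t s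
| cong_trans s t u of cong S s t & cong S t u : cong S s u
| cong_opp s s' of cong S s s' : cong S (- s) (- s')
| cong_add s s' t t' of cong S s s' & cong S t t' : cong S (s + t) (s' + t')
| cong_mul s s' t t' of cong S s s' & cong S t t' : cong S (s * t) (s' * t')
| cong_scale a s s' of cong S s s' : cong S (a *: s) (a *: s')
| cong_addA s t u : cong S (s + (t + u)) (s + t + u)
| cong_addC s t : cong S (s + t) (t + s)
| cong_add0 s : cong S (0 + s) s
| cong_addN s : cong S (- s + s) 0
| cong_mulA s t u : cong S (s * (t * u)) (s * t * u)
| cong_mul1l s : cong S (1 * s) s
| cong_mul1r s : cong S (s * 1) s
| cong_mulDl s t u : cong S ((s + t) * u) (s * u + t * u)
| cong_mulDr s t u : cong S (s * (t + u)) (s * t + s * u)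
| cong_scaleA a b s : cong S (a *: (b *: s)) ((a * b)%R *: s)
| cong_scale1 s : cong S (1%R *: s) s
| cong_scaleDr a s t : cong S (a *: (s + t)) (a *: s + a *: t)
| cong_scaleDl a b s : cong S ((a + b)%R *: s) (a *: s + b *: s)
| cong_scaleAl a s t : cong S (a *: (s * t)) ((a *: s) * t)
| cong_scaleAr a s t : cong S (a *: (s * t)) (s * (a *: t)).

Fixpoint eval (A : algType K) (f : G -> A) s : A :=
  match s with
  | Gen g => f g
  | Zero => 0
  | One => 1
  | Opp s => - eval f s
  | Add s t => eval f s + eval f t
  | Mul s t => eval f s * eval f t
  | Scale a s => a *: eval f s
  end.

Definition satisfies S (A : algType K) (f : G -> A) :=
  forall s t, S s t -> eval f s = eval f t.

Lemma cong_eval S (A : algType K) (f : G -> A) s t :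
  satisfies S f -> cong S s t -> eval f s = eval f t.
Proof.
move=> Sf; elim=> {s t} //=.
- by move=> s t u _ -> _ ->.
- by move=> s s' _ ->.
- by move=> s s' t t' _ -> _ ->.
- by move=> s s' t t' _ -> _ ->.
- by move=> a s s' _ ->.
- by move=> *; rewrite addrA.
- by move=> *; rewrite addrC.
- by move=> *; rewrite add0r.
- by move=> *; rewrite addNr.
- by move=> *; rewrite mulrA.
- by move=> *; rewrite mul1r.
- by move=> *; rewrite mulr1.
- by move=> *; rewrite mulrDl.
- by move=> *; rewrite mulrDr.
- by move=> *; rewrite scalerA.
- by move=> *; rewrite scale1r.
- by move=> *; rewrite scalerDr.
- by move=> *; rewrite scalerDl.
- by move=> *; rewrite scalerAl.
- by move=> *; rewrite scalerAr.
Qed.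

Lemma cong_proper S (A : algType K) (f : G -> A) :
  satisfies S f -> ~ cong S 1 0.
Proof. by move=> Sf /(cong_eval Sf)/eqP; rewrite oner_eq0. Qed.

(* MathComp algebras are nontrivial, hence the second field. *)
Record presentation := Presentation {
  relation_of :> expr K G -> expr K G -> Prop;
  relation_proper : ~ cong relation_of 1 0
}.

Definition congb S : rel (expr K G) := fun s t => `[< cong S s t >].

Lemma congb_equiv S : equiv_class_of (congb S).
Proof.
split=> [s|s t|t s u]; first exact/asboolP/cong_refl.
  by apply/asboolP/asboolP; apply: cong_sym.
by move=> /asboolP st /asboolP tu; apply/asboolP/(cong_trans st).
Qed.
Canonical congb_equivRel S := EquivRelPack (congb_equiv S).
Canonical congb_encModRel S := defaultEncModRel (congb S).

End Congruence.

Definition presented (K : comNzRingType) (G : Type) (P : presentation K G) :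
  Type := {eq_quot congb P}.
HB.instance Definition _ K G P := Choice.on (@presented K G P).

HB.lock Definition class_of (K : comNzRingType) (G : Type)
  (P : presentation K G) (s : expr K G) : presented P := \pi_{eq_quot congb P} s.

HB.lock Definition rep (K : comNzRingType) (G : Type)
  (P : presentation K G) (u : presented P) : expr K G :=
  repr (u : {eq_quot congb P}).

HB.lock Definition pres_opp (K : comNzRingType) (G : Type)
  (P : presentation K G) (u : presented P) := class_of P (- rep u).
HB.lock Definition pres_add (K : comNzRingType) (G : Type)
  (P : presentation K G) (u v : presented P) := class_of P (rep u + rep v).
HB.lock Definition pres_mul (K : comNzRingType) (G : Type)
  (P : presentation K G) (u v : presented P) := class_of P (rep u * rep v).
HB.lock Definition pres_scale (K : comNzRingType) (G : Type)
  (P : presentation K G) (c : K) (u : presented P) := class_of P (c *: rep u).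

Section PresentedAlgebra.
Variables (K : comNzRingType) (G : Type) (P : presentation K G).
Local Notation "[ s ]" := (class_of P s%X).

Lemma class_ofP s t : [s] = [t] <-> cong P s t.
Proof.
rewrite class_of.unlock; split=> [/eqmodP/asboolP //|st].
by apply/eqmodP/asboolP.
Qed.

Lemma repK : cancel (@rep K G P) (class_of P).
Proof. by move=> u; rewrite class_of.unlock rep.unlock reprK. Qed.

Lemma repE s : cong P (rep [s]) s.
Proof. by apply/class_ofP; rewrite repK. Qed.

Let oppE s : pres_opp [s] = [- s].
Proof. by rewrite pres_opp.unlock; apply/class_ofP/cong_opp/repE. Qed.
Let addE s t : pres_add [s] [t] = [s + t].
Proof. by rewrite pres_add.unlock; apply/class_ofP/cong_add; apply: repE. Qed.
Let mulE s t : pres_mul [s] [t] = [s * t].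
Proof. by rewrite pres_mul.unlock; apply/class_ofP/cong_mul; apply: repE. Qed.
Let scaleE c s : pres_scale c [s] = [c *: s].
Proof. by rewrite pres_scale.unlock; apply/class_ofP/cong_scale/repE. Qed.

Fact pres_addA : associative (@pres_add K G P).
Proof.
move=> u v w; rewrite -[u]repK -[v]repK -[w]repK !addE.
exact/class_ofP/cong_addA.
Qed.
Fact pres_addC : commutative (@pres_add K G P).
Proof.
by move=> u v; rewrite -[u]repK -[v]repK !addE; apply/class_ofP/cong_addC.
Qed.
Fact pres_add0 : left_id [0] (@pres_add K G P).
Proof. by move=> u; rewrite -[u]repK addE; apply/class_ofP/cong_add0. Qed.
Fact pres_addN : left_inverse [0] (@pres_opp K G P) (@pres_add K G P).
Proof.
by move=> u; rewrite -[u]repK oppE addE; apply/class_ofP/cong_addN.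
Qed.
HB.instance Definition _ :=
  GRing.isZmodule.Build (presented P) pres_addA pres_addC pres_add0 pres_addN.

Let addE' s t : [s] + [t] = [s + t]. Proof. exact: addE. Qed.

Fact pres_mulA : associative (@pres_mul K G P).
Proof.
move=> u v w; rewrite -[u]repK -[v]repK -[w]repK !mulE.
exact/class_ofP/cong_mulA.
Qed.
Fact pres_mul1 : left_id [1] (@pres_mul K G P).
Proof. by move=> u; rewrite -[u]repK mulE; apply/class_ofP/cong_mul1l. Qed.
Fact pres_mulr1 : right_id [1] (@pres_mul K G P).
Proof. by move=> u; rewrite -[u]repK mulE; apply/class_ofP/cong_mul1r. Qed.
Fact pres_mulDl : left_distributive (@pres_mul K G P) +%R.
Proof.
move=> u v w; rewrite -[u]repK -[v]repK -[w]repK addE' !mulE addE'.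
exact/class_ofP/cong_mulDl.
Qed.
Fact pres_mulDr : right_distributive (@pres_mul K G P) +%R.
Proof.
move=> u v w; rewrite -[u]repK -[v]repK -[w]repK addE' !mulE addE'.
exact/class_ofP/cong_mulDr.
Qed.
Fact pres_one_neq0 : [1] != 0.
Proof. by apply/eqP => /class_ofP; apply: relation_proper. Qed.
HB.instance Definition _ := GRing.Zmodule_isNzRing.Build (presented P)
  pres_mulA pres_mul1 pres_mulr1 pres_mulDl pres_mulDr pres_one_neq0.

Fact pres_scaleA a b (u : presented P) :
  pres_scale a (pres_scale b u) = pres_scale (a * b) u.
Proof. by rewrite -[u]repK !scaleE; apply/class_ofP/cong_scaleA. Qed.
Fact pres_scale1 : left_id 1 (@pres_scale K G P).
Proof. by move=> u; rewrite -[u]repK scaleE; apply/class_ofP/cong_scale1. Qed.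
Fact pres_scaleDr : right_distributive (@pres_scale K G P) +%R.
Proof.
move=> a u v; rewrite -[u]repK -[v]repK addE' !scaleE addE'.
exact/class_ofP/cong_scaleDr.
Qed.
Fact pres_scaleDl u : {morph (@pres_scale K G P)^~ u : a b / a + b}.
Proof.
move=> a b; rewrite -[u]repK !scaleE addE'.
exact/class_ofP/cong_scaleDl.
Qed.
HB.instance Definition _ := GRing.Zmodule_isLmodule.Build K (presented P)
  pres_scaleA pres_scale1 pres_scaleDr pres_scaleDl.

Lemma class_of0 : [0] = 0. Proof. by []. Qed.
Lemma class_of1 : [1] = 1. Proof. by []. Qed.
Lemma class_of_opp s : [- s] = - [s]. Proof. exact/esym/oppE. Qed.
Lemma class_of_add s t : [s + t] = [s] + [t]. Proof. exact/esym/addE. Qed.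
Lemma class_of_mul s t : [s * t] = [s] * [t]. Proof. exact/esym/mulE. Qed.
Lemma class_of_scale a s : [a *: s] = a *: [s].
Proof. exact/esym/scaleE. Qed.

Fact pres_scaleAl a (u v : presented P) : a *: (u * v) = (a *: u) * v.
Proof.
rewrite -[u]repK -[v]repK -!(class_of_mul, class_of_scale).
exact/class_ofP/cong_scaleAl.
Qed.
HB.instance Definition _ :=
  GRing.Lmodule_isLalgebra.Build K (presented P) pres_scaleAl.
Fact pres_scaleAr a (u v : presented P) : a *: (u * v) = u * (a *: v).
Proof.
rewrite -[u]repK -[v]repK -!(class_of_mul, class_of_scale).
exact/class_ofP/cong_scaleAr.
Qed.
HB.instance Definition _ :=
  GRing.Lalgebra_isAlgebra.Build K (presented P) pres_scaleAr.

Definition gen (g : G) : presented P := [Gen K g].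

Lemma class_of_eval s : [s] = eval gen s.
Proof.
elim: s => //= [s <-|s <- t <-|s <- t <-|a s <-].
- exact: class_of_opp.
- exact: class_of_add.
- exact: class_of_mul.
- exact: class_of_scale.
Qed.

Lemma gen_satisfies : satisfies P gen.
Proof.
by move=> s t st; rewrite -!class_of_eval; apply/class_ofP/cong_rel.
Qed.

Lemma presented_lift (A : algType K) (f : G -> A) :
  satisfies P f ->
  exists phi : {lrmorphism presented P -> A}, forall g, phi (gen g) = f g.
Proof.
move=> Pf; pose phi (u : presented P) := eval f (rep u).
have phiE s : phi [s] = eval f s by apply: cong_eval (repE s).
have phiB : zmod_morphism phi.
  by move=> u v; rewrite -[u]repK -[v]repK -class_of_opp -class_of_add !phiE.
have phiM : monoid_morphism phi.
  split=> [|u v]; first by rewrite -class_of1 phiE.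
  by rewrite -[u]repK -[v]repK -class_of_mul !phiE.
have phiZ : scalable phi.
  by move=> a u; rewrite -[u]repK -class_of_scale !phiE.
pose mB := GRing.isZmodMorphism.Build _ _ phi phiB.
pose mM := GRing.isMonoidMorphism.Build _ _ phi phiM.
pose mZ := GRing.isScalable.Build _ _ _ _ phi phiZ.
pose psi : {lrmorphism _ -> _} := HB.pack phi mB mM mZ.
by exists psi => g; apply: phiE.
Qed.

Lemma presented_ext (A : algType K) (phi psi : {lrmorphism presented P -> A}) :
  (forall g, phi (gen g) = psi (gen g)) -> phi =1 psi.
Proof.
move=> eq_gen u; rewrite -[u]repK class_of_eval.
elim: (rep u) => //= [||s IHs|s IHs t IHt|s IHs t IHt|a s IHs].
- by rewrite !raddf0.
- by rewrite !rmorph1.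
- by rewrite !raddfN /= IHs.
- by rewrite !raddfD /= IHs IHt.
- by rewrite !rmorphM /= IHs IHt.
- by rewrite !linearZ /= IHs.
Qed.

End PresentedAlgebra.

(* The index set [n] is 'I_n, with indices starting at 0: [k] is {x | x < k}
   and X_k^+ is {x | k <= x}. *)
Notation inXp k x := (k <= nat_of_ord x)%N.

(* The generators h_x are present for every x in [n], those with x in [k] being
   equated to 1; likewise L^(0) is a generator equated to diag(h_x).  The
   generator hV_x is the inverse of h_x. *)

Section Yangian.
Variables (K : comNzRingType) (k m : nat).
Local Notation n := (k + m)%N.

Inductive Y_gen :=
  Y_gen_h of 'I_n | Y_gen_hV of 'I_n | Y_gen_L of nat & 'I_n & 'I_n.

Local Notation h x := (Gen K (Y_gen_h x)).
Local Notation hV x := (Gen K (Y_gen_hV x)).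
Local Notation L p x y := (Gen K (Y_gen_L p x y)).

Inductive Y_rel : expr K Y_gen -> expr K Y_gen -> Prop :=
| Y_h_1 x of ~~ inXp k x : Y_rel (h x) 1
| Y_h_hV x : Y_rel (h x * hV x) 1
| Y_hV_h x : Y_rel (hV x * h x) 1
| Y_L_0 x y : Y_rel (L 0 x y) (h x *+ (x == y))
| Y_h_h x y of inXp k x & inXp k y : Y_rel [lie h x, h y] 0
| Y_L_h p x y z of inXp k z :
    Y_rel [lie L p x y, h z]
      ((L p x y * h x) *+ 2 *+ (z == x) - (h y * L p x y) *+ 2 *+ (z == y))
| Y_L_L p l x y z w :
    Y_rel
      ([lie L p.+1 x y, L l z w] - [lie L p x y, L l.+1 z w]
       - (L p.+1 x y * L l x w - L p x y * L l.+1 x w)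
           *+ 2 *+ (x == z) *+ inXp k x
       + (L l z y * L p.+1 x y - L l.+1 z y * L p x y)
           *+ 2 *+ (y == w) *+ inXp k y)
      (L l z y * L p x w - L p z y * L l x w).

Lemma Y_rel_proper : ~ cong Y_rel 1 0.
Proof.
pose f g : K^o := match g with
  | Y_gen_h _ | Y_gen_hV _ => 1
  | Y_gen_L p x y => ((p == 0%N) && (x == y))%:R
  end.
apply: (@cong_proper _ _ _ _ f) => s t [] /=.
- by [].
- by move=> x; rewrite mulr1.
- by move=> x; rewrite mulr1.
- by move=> x y; rewrite scaler_nat.
- by move=> x y _ _; rewrite subrr.
- move=> p x y z _; rewrite mulr1 mul1r subrr.
  by case: (x =P y) => [->|_]; rewrite ?andbF ?scaler0 subrr.
- move=> p l x y z w; rewrite !(mul0r, mulr0, subrr, scaler0, addr0, oppr0).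
  by case: p l => [|p] [|l]; rewrite ?(mul0r, mulr0) subrr.
Qed.

Definition Y_presentation := Presentation Y_rel_proper.

Definition Yangian := presented Y_presentation.
HB.instance Definition _ := GRing.Algebra.on Yangian.

Definition Y_h (x : 'I_n) : Yangian := gen Y_presentation (Y_gen_h x).
Definition Y_L (p : nat) (x y : 'I_n) : Yangian :=
  gen Y_presentation (Y_gen_L p x y).

End Yangian.

Section Gl.
Variables (K : comNzRingType) (k m : nat).
Local Notation n := (k + m)%N.

Inductive gl_gen :=
  gl_gen_h of 'I_n | gl_gen_hV of 'I_n | gl_gen_L of 'I_n & 'I_n.

Local Notation h x := (Gen K (gl_gen_h x)).
Local Notation hV x := (Gen K (gl_gen_hV x)).
Local Notation L x y := (Gen K (gl_gen_L x y)).

Inductive gl_rel : expr K gl_gen -> expr K gl_gen -> Prop :=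
| gl_h_1 x of ~~ inXp k x : gl_rel (h x) 1
| gl_h_hV x : gl_rel (h x * hV x) 1
| gl_hV_h x : gl_rel (hV x * h x) 1
| gl_h_h x y of inXp k x & inXp k y : gl_rel [lie h x, h y] 0
| gl_L_h x y z of inXp k z :
    gl_rel [lie L x y, h z]
      ((L x y * h x) *+ 2 *+ (z == x) - (h y * L x y) *+ 2 *+ (y == z))
| gl_L_L x y z w :
    gl_rel
      ([lie L x y, L z w]
       - (L x y * L x w) *+ 2 *+ (x == z) *+ inXp k x
       + (L z y * L x y) *+ 2 *+ (y == w) *+ inXp k y)
      ((L z y * h x) *+ (x == w) - (h y * L x w) *+ (y == z)).

Lemma gl_rel_proper : ~ cong gl_rel 1 0.
Proof.
pose f g : K^o := match g with gl_gen_L _ _ => 0 | _ => 1 end.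
apply: (@cong_proper _ _ _ _ f) => s t [] /=.
- by [].
- by move=> x; rewrite mulr1.
- by move=> x; rewrite mulr1.
- by move=> x y _ _; rewrite subrr.
- by move=> x y z _; rewrite !(mul0r, mulr0, scaler0, subrr).
- by move=> x y z w; rewrite !(mul0r, mulr0, scaler0, subrr, addr0).
Qed.

Definition gl_presentation := Presentation gl_rel_proper.

Definition gl := presented gl_presentation.
HB.instance Definition _ := GRing.Algebra.on gl.

Definition gl_h (x : 'I_n) : gl := gen gl_presentation (gl_gen_h x).
Definition gl_L (x y : 'I_n) : gl := gen gl_presentation (gl_gen_L x y).

End Gl.

(* Main.v *)
(* The Yangian relations with (p, l) = (0, 1) are the relations of gl_{k,m}
   once the L^(2) terms cancel; they do because the relation between L and h is
   invariant under exchanging 2 L h delta_{zx} - 2 h L delta_{zy} with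
   2 L h delta_{zy} - 2 h L delta_{zx} (each h_z commutes or anticommutes with
   each L_{xy}).  Hence gl_{k,m} maps to the Yangian.  This map is injective
   because it is split by the evaluation homomorphism sending L^(0) to
   diag(h), L^(1) to L and L^(p) to 0 for p >= 2. *)

Require Import Defs.
From mathcomp Require Import all_boot all_order all_algebra.
From mathcomp Require Import reals.
From mathcomp.real_closed Require Import complex.
Set Implicit Arguments.
Unset Strict Implicit.
Unset Printing Implicit Defensive.
Import GRing.Theory.
Local Open Scope ring_scope.

(** For [a = b] nothing changes. If exactly one of them is true, the hypothesis says
    [T * H = - (H * T)], so the two possible right-hand sides coincide. No division by 2 is
    involved. *)
Lemma commutator_twistC (A : pzRingType) (a b : bool) (T H : A) :
  T * H - H * T = (T * H) *+ 2 *+ a - (H * T) *+ 2 *+ b ->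
  T * H - H * T = (T * H) *+ 2 *+ b - (H * T) *+ 2 *+ a.
Proof.
case: a b => [] [] //=; rewrite !(subr0, sub0r) mulr2n.
  by move=> /addrI e; rewrite mulr2n opprD e.
by rewrite opprD => /addIr e; rewrite mulr2n -e.
Qed.

(** * Relations in the Yangian, down to its degree-one part *)

Section Yangian.
Variables (K : comNzRingType) (k m : nat).
Local Notation n := (k + m)%N.
Local Notation h := (@Y_h K k m).
Local Notation L := (@Y_L K k m).

Lemma Y_h_eq1 x : ~~ inXp k x -> h x = 1.
Proof.
by move=> kx; apply: (gen_satisfies (P := Y_presentation K k m) (Y_h_1 K kx)).
Qed.

Lemma Y_L0E x y : L 0 x y = h x *+ (x == y).
Proof.
by have /= := gen_satisfies (P := Y_presentation K k m) (Y_L_0 K x y);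
  rewrite scaler_nat.
Qed.

(** The deltas allow [h x] and [h y] to be replaced by [h z]; the indicator extends the relation to
    [z] in [k], where [h z = 1] is central. *)
Lemma Y_L_hE p x y z :
  L p x y * h z - h z * L p x y =
    (L p x y * h z) *+ 2 *+ (z == x) *+ inXp k z
    - (h z * L p x y) *+ 2 *+ (z == y) *+ inXp k z.
Proof.
case: (boolP (inXp k z)) => [kz|/Y_h_eq1->]; last by rewrite mulr1 mul1r !subrr.
have /= := gen_satisfies (P := Y_presentation K k m) (Y_L_h K p x y kz).
rewrite !scaler_nat -/(Y_L _ _ _ _) -!/(Y_h _ _) => ->.
by case: eqP => [->|_]; case: eqP => [->|_].
Qed.

Lemma Y_L_LE p l x y z w :
  (L p.+1 x y * L l z w - L l z w * L p.+1 x y)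
  - (L p x y * L l.+1 z w - L l.+1 z w * L p x y)
  - (L p.+1 x y * L l x w - L p x y * L l.+1 x w) *+ 2 *+ (x == z) *+ inXp k x
  + (L l z y * L p.+1 x y - L l.+1 z y * L p x y) *+ 2 *+ (y == w) *+ inXp k y
  = L l z y * L p x w - L p z y * L l x w.
Proof.
have /= := gen_satisfies (P := Y_presentation K k m) (Y_L_L K p l x y z w).
by rewrite !scaler_nat.
Qed.

Lemma Y_L_hC p x y z :
  L p x y * h z - h z * L p x y =
    (L p x y * h z) *+ 2 *+ (z == y) *+ inXp k z
    - (h z * L p x y) *+ 2 *+ (z == x) *+ inXp k z.
Proof.
have := Y_L_hE p x y z; case: (inXp k z); last by [].
exact: commutator_twistC.
Qed.

Lemma Y_L1_L1 x y z w :
  (L 1 x y * L 1 z w - L 1 z w * L 1 x y)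
  - (L 1 x y * L 1 x w) *+ 2 *+ (x == z) *+ inXp k x
  + (L 1 z y * L 1 x y) *+ 2 *+ (y == w) *+ inXp k y
  = (L 1 z y * h x) *+ (x == w) - (h y * L 1 x w) *+ (y == z).
Proof.
have := Y_L_LE 0 1 x y z w; rewrite !Y_L0E (eq_sym z y).
have -> : L 1 z y * (h x *+ (x == w)) - h z *+ (y == z) * L 1 x w =
    (L 1 z y * h x) *+ (x == w) - (h y * L 1 x w) *+ (y == z).
  by rewrite mulrnAr mulrnAl; case: (y =P z) => [->|].
(* Every [L 2] term carries the factor [L 0 x y], which is zero off the diagonal. *)
move=> <-; case: (x =P y) => [<-|_]; last by rewrite !(mul0r, mulr0, subr0).
rewrite !mulr1n.
have -> : h x * L 2 z w - L 2 z w * h x = - (L 2 z w * h x - h x * L 2 z w).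
  by rewrite opprB.
(* The exchanged form attaches the delta of [x] and [w] to [L 2 z w * h x] and that of [x] and [z]
   to [h x * L 2 z w], exactly as in the twist terms to be cancelled. *)
rewrite Y_L_hC opprK !mulrnBl -!mulrnA.
have -> : h x * L 2 x w *+ (2 * ((x == z) * inXp k x)) =
   h x * L 2 z w *+ (2 * ((x == z) * inXp k x)) by case: eqP => [->|].
have -> : L 2 z x * h x *+ (2 * ((x == w) * inXp k x)) =
   L 2 z w * h x *+ (2 * ((x == w) * inXp k x)) by case: eqP => [->|].
set a := _ - L 1 z w * _; set b := L 2 z w * h x *+ _.
set c := h x * _ *+ _; set d := _ *+ _; set e := _ *+ _.
by rewrite opprB !addrA subrK (addrAC a b) (addrAC _ b e) addrK.
Qed.

End Yangian.

(** * Relations in the algebra [gl] *)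

Section Evaluation.
Variables (K : comNzRingType) (k m : nat).
Local Notation n := (k + m)%N.
Local Notation h := (@gl_h K k m).
Local Notation L := (@gl_L K k m).

Lemma gl_h_eq1 x : ~~ inXp k x -> h x = 1.
Proof.
by move=> kx; apply: (gen_satisfies (P := gl_presentation K k m) (gl_h_1 K kx)).
Qed.

Lemma gl_h_comm x y : h x * h y = h y * h x.
Proof.
case: (boolP (inXp k x)) => [kx|/gl_h_eq1->]; last by rewrite mulr1 mul1r.
case: (boolP (inXp k y)) => [ky|/gl_h_eq1->]; last by rewrite mulr1 mul1r.
apply/eqP; rewrite -subr_eq0; apply/eqP.
exact: (gen_satisfies (P := gl_presentation K k m) (gl_h_h K kx ky)).
Qed.

Lemma gl_L_hE x y z :
  L x y * h z - h z * L x y =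
    (L x y * h z) *+ 2 *+ (z == x) *+ inXp k z
    - (h z * L x y) *+ 2 *+ (z == y) *+ inXp k z.
Proof.
case: (boolP (inXp k z)) => [kz|/gl_h_eq1->].
  have /= := gen_satisfies (P := gl_presentation K k m) (gl_L_h K x y kz).
  rewrite !scaler_nat -/(gl_L _ _ _) -!/(gl_h _ _) (eq_sym y) => ->.
  by case: eqP => [->|_]; case: eqP => [->|_].
by rewrite mulr1 mul1r !subrr.
Qed.

Lemma gl_L_hC x y z :
  L x y * h z - h z * L x y =
    (L x y * h z) *+ 2 *+ (z == y) *+ inXp k z
    - (h z * L x y) *+ 2 *+ (z == x) *+ inXp k z.
Proof.
have := gl_L_hE x y z; case: (inXp k z); last by [].
exact: commutator_twistC.
Qed.

(** On the diagonal both deltas agree, so the commutator [c] satisfies [c = 0] or [c = c *+ 2];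
    either way it vanishes. *)
Lemma gl_L_hdiag x z : L x x * h z = h z * L x x.
Proof.
apply/eqP; rewrite -subr_eq0; apply/eqP; have := gl_L_hE x x z.
rewrite -!mulrnBl; case: eqP => _; last by rewrite mulr0n mul0rn.
by case: (inXp k z) => //; rewrite mulr1n mulr2n -{1}[LHS]addr0 => /addrI.
Qed.

Lemma gl_L_LE x y z w :
  (L x y * L z w - L z w * L x y)
  - (L x y * L x w) *+ 2 *+ (x == z) *+ inXp k x
  + (L z y * L x y) *+ 2 *+ (y == w) *+ inXp k y
  = (L z y * h x) *+ (x == w) - (h y * L x w) *+ (y == z).
Proof.
have /= := gen_satisfies (P := gl_presentation K k m) (gl_L_L K x y z w).
by rewrite !scaler_nat.
Qed.

(** Taking [(z, w) = (x, y)] kills the commutator, and [x != y] kills the right-hand side; exactly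
    one twist term survives. The factor 2 stays because [K] is any commutative ring. *)
Lemma gl_L_sqr2 x y :
  (~~ inXp k x /\ inXp k y) \/ (inXp k x /\ ~~ inXp k y) ->
  L x y ^+ 2 *+ 2 = 0.
Proof.
move=> kxy; have := gl_L_LE x y x y; rewrite !eqxx subrr.
have /negPf xy : x != y 
  by apply/eqP => xy; case: kxy; rewrite xy; case: (inXp k y) => -[].
rewrite xy (eq_sym y) xy subrr -expr2 sub0r.
case: kxy => [] [kx ky]; rewrite ?kx ?ky ?(negPf kx) ?(negPf ky) /=.
  by rewrite oppr0 add0r.
by rewrite addr0 => /eqP; rewrite oppr_eq0 => /eqP.
Qed.

(** * The evaluation homomorphism from the Yangian *)

Definition gl_series p x y : gl K k m :=
  match p with 0 => h x *+ (x == y) | 1 => L x y | _ => 0 end.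

Definition Y_eval g : gl K k m :=
  match g with
  | Y_gen_h x => h x
  | Y_gen_hV x => gen (gl_presentation K k m) (gl_gen_hV x)
  | Y_gen_L p x y => gl_series p x y
  end.

Lemma gl_series_h p x y z : inXp k z ->
  gl_series p x y * h z - h z * gl_series p x y =
    (gl_series p x y * h x) *+ 2 *+ (z == x)
    - (h y * gl_series p x y) *+ 2 *+ (z == y).
Proof.
move=> kz; case: p => [|[|p]] /=;
    last by rewrite !(mulr0n, mulr0, mul0r, mul0rn, subrr).
  case: (x =P y) => [<-|_];
    last by rewrite !(mulr0n, mulr0, mul0r, mul0rn, subrr).
  by rewrite !mulr1n gl_h_comm !subrr.
by rewrite gl_L_hE kz; case: eqP => [->|_]; case: eqP => [->|_].
Qed.

(** This is the Yangian relation at [p = l = 0], where the right-hand side cancels. Diagonal entries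
    commute with all [h]; if only [z = w], the twists cancel by [gl_L_hE]; if only [x = y], by the
    exchanged [gl_L_hC]; otherwise the deltas are incompatible. *)
Lemma gl_series00 x y z w :
  (L x y * gl_series 0 z w - gl_series 0 z w * L x y)
  - (gl_series 0 x y * L z w - L z w * gl_series 0 x y)
  - (L x y * gl_series 0 x w - gl_series 0 x y * L x w)
      *+ 2 *+ (x == z) *+ inXp k x
  + (gl_series 0 z y * L x y - L z y * gl_series 0 x y)
      *+ 2 *+ (y == w) *+ inXp k y
  = 0.
Proof.
rewrite /=; case: (z =P w) => [<-|zw]; case: (x =P y) => [<-|xy].
- rewrite !mulr1n gl_L_hdiag (gl_L_hdiag z) !subrr (eq_sym z).
  case: (x =P z) => [<-|_]; last by rewrite !(mulr0n, mul0rn, subr0, addr0).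
  by rewrite !mulr1n gl_L_hdiag !subrr !mul0rn subrr addr0.
- rewrite !mulr1n !mulr0n !(mul0r, mulr0, subr0) gl_L_hE !(eq_sym z).
  have -> : L x y * (h x *+ (x == z)) *+ 2 *+ (x == z) *+ inXp k x =
      L x y * h z *+ 2 *+ (x == z) *+ inXp k z.
    by case: eqP => [->|_] //; rewrite !mulr0n !mul0rn.
  have -> : h z *+ (y == z) * L x y *+ 2 *+ (y == z) *+ inXp k y =
      h z * L x y *+ 2 *+ (y == z) *+ inXp k z.
    by case: eqP => [->|_] //; rewrite !mulr0n !mul0rn.
  by rewrite addrAC subrK subrr.
- rewrite !mulr1n !mulr0n !(mul0r, mulr0, sub0r) opprB gl_L_hC oppr0 add0r.
  have -> : (L x x * (h x *+ (x == w)) - h x * L x w) *+ 2 *+ (x == z) =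
      - (h x * L z w *+ 2 *+ (x == z)).
    case: (x =P z) => [->|_]; last by rewrite !mulr0n oppr0.
    by rewrite (introF eqP zw) mulr0n mulr0 sub0r !mulr1n mulNrn.
  have -> : (h z *+ (z == x) * L x x - L z x * h x) *+ 2 *+ (x == w) =
      - (L z w * h x *+ 2 *+ (x == w)).
    case: (x =P w) => [->|_]; last by rewrite !mulr0n oppr0.
    by rewrite (introF eqP zw) mulr0n mul0r sub0r !mulr1n mulNrn.
  by rewrite !mulNrn opprK subrK subrr.
- rewrite !mulr0n !(mul0r, mulr0, subr0, sub0r, oppr0).
  have -> : L x y * (h x *+ (x == w)) *+ 2 *+ (x == z) = 0.
    case: (x =P z) => [->|_] //.
    by rewrite (introF eqP zw) mulr0n mulr0 !mul0rn.
  have -> : h z *+ (z == y) * L x y *+ 2 *+ (y == w) = 0.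
    case: (y =P w) => [->|_] //.
    by rewrite (introF eqP zw) mulr0n mul0r !mul0rn.
  by rewrite !mul0rn oppr0 addr0.
Qed.

Lemma gl_series_L p l x y z w :
  let T := gl_series in
  (T p.+1 x y * T l z w - T l z w * T p.+1 x y)
  - (T p x y * T l.+1 z w - T l.+1 z w * T p x y)
  - (T p.+1 x y * T l x w - T p x y * T l.+1 x w) *+ 2 *+ (x == z) *+ inXp k x
  + (T l z y * T p.+1 x y - T l.+1 z y * T p x y) *+ 2 *+ (y == w) *+ inXp k y
  = T l z y * T p x w - T p z y * T l x w.
Proof.
have e01 : (L z y * h x) *+ (x == w) - (h y * L x w) *+ (y == z) =
    L z y * (h x *+ (x == w)) - h z *+ (z == y) * L x w.
  by rewrite mulrnAr mulrnAl; case: (z =P y) => [->|/nesym/eqP/negPf->];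
    rewrite ?eqxx.
case: p l => [|[|p]] [|[|l]] /=.
- by rewrite gl_series00 subrr.
- by rewrite !(mul0r, mulr0, subr0) gl_L_LE e01.
- by rewrite !(mul0r, mulr0, subr0, mul0rn, addr0).
(* The relation at [(p, l) = (1, 0)] is the negative of the one at [(0, 1)]. *)
- rewrite -[RHS]opprB -e01 -gl_L_LE [in RHS]opprD [in RHS]opprD.
  by rewrite !(mul0r, mulr0, subr0, oppr0, add0r, mulNrn, opprK).
(* At [(1, 1)] the two products on the right coincide; in the other cases every product has a factor
   of degree at least 2. *)
all: by rewrite !(mul0r, mulr0, subr0, mul0rn, addr0, subrr).
Qed.

Lemma Y_eval_satisfies : satisfies (Y_presentation K k m) Y_eval.
Proof.
have gl_gen := gen_satisfies (P := gl_presentation K k m).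
move=> s t [] /=.
- by move=> x /gl_h_eq1.
- by move=> x; apply: gl_gen (gl_h_hV _ _).
- by move=> x; apply: gl_gen (gl_hV_h _ _).
- by move=> x y; rewrite scaler_nat.
- by move=> x y _ _; rewrite gl_h_comm subrr.
- by move=> p x y z kz; rewrite !scaler_nat gl_series_h.
- by move=> p l x y z w; rewrite !scaler_nat gl_series_L.
Qed.

(** * The embedding and the vanishing squares *)

Definition gl_incl g : Yangian K k m :=
  match g with
  | gl_gen_h x => Y_h K x
  | gl_gen_hV x => gen (Y_presentation K k m) (Y_gen_hV x)
  | gl_gen_L x y => Y_L K 1 x y
  end.

Lemma gl_incl_satisfies : satisfies (gl_presentation K k m) gl_incl.
Proof.
have Y_gen := gen_satisfies (P := Y_presentation K k m).
move=> s t [] /=.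
- by move=> x /Y_h_eq1.
- by move=> x; apply: Y_gen (Y_h_hV _ _).
- by move=> x; apply: Y_gen (Y_hV_h _ _).
- by move=> x y kx ky; apply: Y_gen (Y_h_h K kx ky).
- move=> x y z kz; rewrite !scaler_nat Y_L_hE kz (eq_sym y).
  by case: eqP => [->|_]; case: eqP => [->|_].
- by move=> x y z w; rewrite !scaler_nat Y_L1_L1.
Qed.

Lemma gl_Yangian_embedding :
  exists phi : {lrmorphism gl K k m -> Yangian K k m},
    [/\ forall z, phi (h z) = Y_h _ z,
        forall x y, phi (L x y) = Y_L _ 1 x y
      & injective phi].
Proof.
have [phi phiE] := presented_lift gl_incl_satisfies.
have [psi psiE] := presented_lift Y_eval_satisfies.
exists phi; split=> [z|x y|].
- exact: phiE.
- exact: phiE.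
(* Evaluation is a left inverse: the composite fixes all generators, including the inverses of the
   [h]. *)
apply: (can_inj (g := psi)) => u.
pose psiphi : {lrmorphism gl K k m -> gl K k m} := psi \o phi.
pose idgl : {lrmorphism gl K k m -> gl K k m} := idfun.
apply: (presented_ext (phi := psiphi) (psi := idgl)) => g /=.
by rewrite phiE; case: g => *; apply: psiE.
Qed.

End Evaluation.

Theorem corollary2p4 (R : realType) (k m : nat) (k_lt_n : (k < k + m)%N) :
  (exists phi : {lrmorphism gl R[i] k m -> Yangian R[i] k m},
     [/\ forall z : 'I_(k + m), phi (gl_h _ z) = Y_h _ z,
         forall x y : 'I_(k + m), phi (gl_L _ x y) = Y_L _ 1 x y
       & injective phi]) /\
  (forall x y : 'I_(k + m),
     (~~ inXp k x /\ inXp k y) \/ (inXp k x /\ ~~ inXp k y) ->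
     gl_L R[i] x y ^+ 2 = 0 /\ Y_L R[i] 1 x y ^+ 2 = 0).
Proof.
have [phi [phih phiL phi_inj]] := gl_Yangian_embedding R[i] k m.
split=> [|x y kxy]; first by exists phi.
suff L2 : gl_L R[i] x y ^+ 2 = 0 by rewrite -phiL -rmorphXn L2 raddf0.
(* Over the field [R[i]] of characteristic zero the factor 2 can be cancelled. *)
apply/eqP; have /eqP := gl_L_sqr2 R[i] kxy.
by rewrite -scaler_nat scaler_eq0 Num.Theory.pnatr_eq0.
Qed.
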